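(* Let $p>2$, $\alpha\in\mathbb{R}$ and $\mu>0$. If $u$ is a ground state of mass $\mu$ (i.e. $u\in D_\mu$ and $E(u)=\inf_{v\in D_\mu}E(v)$), then $u$ is also a minimizer of the action at the frequency $\omega=\mu^{-1}\big(\|u\|_p^p-Q(u)\big)$, i.e. $u\in N_\omega$ and $S_\omega(u)=\inf_{v\in N_\omega}S_\omega(v)$.
   Context: Functions on $\mathbb{R}^2$ are complex valued and $\|\cdot\|_p$ is the norm of $L^p(\mathbb{R}^2)$. For $\lambda>0$, $\mathcal{G}_\lambda(\mathbf{x})=\frac{1}{2\pi}K_0(\sqrt{\lambda}|\mathbf{x}|)$ is the Green's function of $-\Delta+\lambda$ on $\mathbb{R}^2$ ($K_0$ is the modified Bessel function of the second kind of order $0$), and $$\theta_\lambda:=\frac{\log\left(\frac{\sqrt{\lambda}}{2}\right)+\gamma}{2\pi},$$ with $\gamma$ the Euler-Mascheroni constant. The energy space is $$D:=\{v\in L^2(\mathbb{R}^2):\exists q\in\mathbb{C},\ \lambda>0 \text{ such that } v-q\mathcal{G}_\lambda=:\phi_\lambda\in H^1(\mathbb{R}^2)\}.$$ For $v\in D$ the charge $q$ is uniquely determined by $v$ and does not depend on $\lambda$, and the decomposition $v=\phi_\lambda+q\mathcal{G}_\lambda$ with $\phi_\lambda\in H^1(\mathbb{R}^2)$ is available for every $\lambda>0$. The quadratic form $$Q(v):=\|\nabla\phi_\lambda\|_2^2+\lambda\big(\|\phi_\lambda\|_2^2-\|v\|_2^2\big)+(\alpha+\theta_\lambda)|q|^2,\qquad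 v\in D,$$ is independent of the choice of $\lambda>0$. For $v\in D$ and $\omega\in\mathbb{R}$: the energy is $E(v):=\frac12Q(v)-\frac1p\|v\|_p^p$, the action is $S_\omega(v):=E(v)+\frac{\omega}{2}\|v\|_2^2$, and $I_\omega(v):=Q(v)+\omega\|v\|_2^2-\|v\|_p^p$. The Nehari manifold is $N_\omega:=\{v\in D\setminus\{0\}:I_\omega(v)=0\}$. For $\mu>0$, $D_\mu:=\{v\in D:\|v\|_2^2=\mu\}$. *)

(* Defs.v *)
From HB Require Import structures.
From mathcomp Require Import all_boot all_order all_algebra.
From mathcomp Require Import all_classical all_reals all_analysis.
From mathcomp Require Import complex.

Set Implicit Arguments.
Unset Strict Implicit.
Unset Printing Implicit Defensive.

Import Order.TTheory GRing.Theory Num.Theory.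
Import numFieldTopology.Exports numFieldNormedType.Exports.
Import ComplexField.Normc.

Local Open Scope classical_set_scope.
Local Open Scope ring_scope.

Section LpPlane.
Context {R : realType}.

Definition leb2 := (@lebesgue_measure R \x @lebesgue_measure R)%E.

(* Elements of the function spaces are represented by functions; all the
   notions below are invariant under equality almost everywhere. *)
Implicit Types (u v w phi : R * R -> R[i]).

Definition cmeasurable v :=
  measurable_fun [set: measurableTypeR R * measurableTypeR R]
    (fun x => complex.Re (v x) : measurableTypeR R) /\
  measurable_fun [set: measurableTypeR R * measurableTypeR R]
    (fun x => complex.Im (v x) : measurableTypeR R).

Definition eLp_norm (p : R) v : \bar R :=
  ('N[leb2]_p%:E[EFin \o (fun x => normc (v x))])%E.

(* The norm as a real number: meaningful when [eLp_norm p v] is finite. *)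
Definition Lp_norm (p : R) v : R := fine (eLp_norm p v).

Definition Lp (p : R) v := cmeasurable v /\ (eLp_norm p v < +oo)%E.

Definition cintegral v : R[i] :=
  Complex (\int[leb2]_x complex.Re (v x)) (\int[leb2]_x complex.Im (v x)).

End LpPlane.

Section Sobolev.
Context {R : realType}.
Implicit Types (psi : R * R -> R) (phi g : R * R -> R[i]).

(* [axis false] and [axis true] are the two vectors of the canonical basis. *)
Definition axis (i : bool) : R * R := if i then (0, 1) else (1, 0).

Definition partial (i : bool) psi : R * R -> R := fun x => 'D_(axis i) psi x.

Definition iter_partial (s : seq bool) psi := foldr partial psi s.

(* All iterated partial derivatives exist and are continuous. *)
Definition smooth psi := forall s : seq bool,
  continuous (iter_partial s psi) /\
  forall (i : bool) (x : R * R), derivable (iter_partial s psi) x (axis i).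

Definition test_function psi :=
  smooth psi /\ compact (closure [set x | psi x != 0]).

Definition weak_partial (i : bool) phi g := forall psi, test_function psi ->
  cintegral (fun x => phi x * (partial i psi x)%:C%C) =
  - cintegral (fun x => g x * (psi x)%:C%C).

Definition weak_gradient phi (G : bool -> R * R -> R[i]) :=
  forall i, Lp 2 (G i) /\ weak_partial i phi (G i).

Definition H1 phi := Lp 2 phi /\ exists G, weak_gradient phi G.

End Sobolev.

Section DeltaInteraction.
Context {R : realType}.
Implicit Types (lambda mu omega alpha p : R) (q : R[i]).
Implicit Types (u v phi : R * R -> R[i]).

(* The integral representation, valid for z > 0, of the modified Bessel
   function of the second kind of order 0. *)
Definition besselK0 (z : R) : R :=
  \int[lebesgue_measure]_(t in `[0, +oo[)
    expR (- z * ((expR t + expR (- t)) / 2)).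

Definition euler_gamma : R :=
  limn (fun n : nat => series harmonic n - ln n%:R).

Definition enorm (x : R * R) : R := Num.sqrt (x.1 ^+ 2 + x.2 ^+ 2).

Definition green lambda (x : R * R) : R :=
  (2 * pi)^-1 * besselK0 (Num.sqrt lambda * enorm x).

Definition theta lambda : R :=
  (ln (Num.sqrt lambda / 2) + euler_gamma) / (2 * pi).

Definition regular_part lambda q v : R * R -> R[i] :=
  fun x => v x - q * (green lambda x)%:C%C.

Definition energy_space v := Lp 2 v /\
  exists q lambda, 0 < lambda /\ H1 (regular_part lambda q v).

(* [G] is the weak gradient of the regular part. *)
Definition form_value alpha v lambda q (G : bool -> R * R -> R[i]) : R :=
  let phi := regular_part lambda q v in
  (Lp_norm 2 (G false) ^+ 2 + Lp_norm 2 (G true) ^+ 2)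
  + lambda * (Lp_norm 2 phi ^+ 2 - Lp_norm 2 v ^+ 2)
  + (alpha + theta lambda) * normc q ^+ 2.

(* The values given by all admissible decompositions v = phi + q G_lambda. *)
Definition form_values alpha v : set R :=
  [set r | exists lambda q G,
    [/\ 0 < lambda, Lp 2 (regular_part lambda q v),
        weak_gradient (regular_part lambda q v) G &
        r = form_value alpha v lambda q G]].

(* For v in the energy space, [form_values alpha v] is a singleton: q is
   determined by v, the weak gradient is unique almost everywhere, and the
   formula does not depend on lambda. Here [inf] only extracts its element. *)
Definition Qform alpha v : R := inf (form_values alpha v).

Definition energy alpha p v : R :=
  Qform alpha v / 2 - (Lp_norm p v `^ p) / p.

Definition action alpha p omega v : R :=
  energy alpha p v + omega / 2 * Lp_norm 2 v ^+ 2.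

Definition nehari_functional alpha p omega v : R :=
  Qform alpha v + omega * Lp_norm 2 v ^+ 2 - Lp_norm p v `^ p.

(* v is nonzero as an element of L^2, that is, up to null sets. *)
Definition nehari alpha p omega : set (R * R -> R[i]) :=
  [set v | [/\ energy_space v, ~ {ae leb2, forall x, v x = 0} &
               nehari_functional alpha p omega v = 0]].

Definition mass_sphere mu : set (R * R -> R[i]) :=
  [set v | energy_space v /\ Lp_norm 2 v ^+ 2 = mu].

Definition ground_state alpha p mu u :=
  mass_sphere mu u /\
  (energy alpha p u)%:E =
    ereal_inf [set (energy alpha p v)%:E | v in mass_sphere mu].

Definition action_minimizer alpha p omega u :=
  nehari alpha p omega u /\
  (action alpha p omega u)%:E =
    ereal_inf [set (action alpha p omega v)%:E | v in nehari alpha p omega].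

End DeltaInteraction.

(* Main.v *)
(** Restricted to a ray [s *: v] with [v] on the Nehari manifold, the action is
    [(s^2 / 2 - s^p / p) ||v||_p^p], which is largest at [s = 1].  Choosing [s]
    such that [s *: v] has the mass of [u], the action of [v] dominates that of
    [s *: v], which in turn dominates that of [u] because, at fixed mass, action
    and energy differ by a constant. *)
Require Import Defs.
From mathcomp Require Import all_boot all_order all_algebra.
From mathcomp Require Import all_classical all_reals all_analysis.
From mathcomp Require Import measurable_realfun complex.
From mathcomp Require Import ring lra.

Import Order.TTheory GRing.Theory Num.Theory.

Local Open Scope ring_scope.

(** * Positive scaling of extended reals and infima *)

Lemma gt0_muleB {R : realDomainType} (k : R) (x y : \bar R) : 0 < k ->
  (k%:E * (x - y) = k%:E * x - k%:E * y)%E.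
Proof.
move=> k0; have [xy|] := boolP (x +? - y)%E; first by rewrite muleBr.
(* Here [x] and [y] are the same infinity: the difference is [-oo] by convention, and a positive
   factor keeps it so. *)
by case: x y => [x| |] [y| |]//= _; rewrite ?gt0_muley ?gt0_muleNy ?lte_fin.
Qed.

(** At an infinite [x] both sides are 0: a positive factor preserves each infinity, and [fine] sends
    it to 0. *)
Lemma fine_gt0Z {R : realDomainType} (k : R) (x : \bar R) : 0 < k ->
  fine (k%:E * x)%E = k * fine x.
Proof.
by move=> k0; case: x => [x| |]//=;
  rewrite ?gt0_muley ?gt0_muleNy ?lte_fin//= mulr0.
Qed.

(** One inequality, proved for every positive factor, gives both: its instance at [k^-1] and the
    scaled set is the converse. *)
Lemma inf_pZl {R : realType} (k : R) (A : set R) : 0 < k ->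
  inf [set k * x | x in A]%classic = k * inf A.
Proof.
gen have has_infZ : k A / 0 < k ->
    has_inf A -> has_inf [set k * x | x in A]%classic.
  move=> k0 [[a Aa] [m mA]]; split; first by exists (k * a), a.
  by exists (k * m) => _ [x Ax <-]; rewrite ler_pM2l// mA.
gen have infZ_le : k A / 0 < k -> has_inf A ->
    k * inf A <= inf [set k * x | x in A]%classic.
  move=> k0 hA; apply: lb_le_inf; first by have [] := has_infZ _ _ k0 hA.
  by move=> _ [x Ax <-]; rewrite ler_pM2l// ge_inf//; case: hA.
move=> k0.
have imK : [set k^-1 * y | y in [set k * x | x in A]]%classic = A.
  rewrite image_comp (_ : _ \o _ = id) ?image_id//.
  by apply/funext => x /=; rewrite mulKf// gt_eqF.
have k'0 : 0 < k^-1 by rewrite invr_gt0.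
have [hA|hA] := pselect (has_inf A).
  apply/le_anti; rewrite infZ_le// andbT -ler_pdivrMl//.
  by have := infZ_le _ _ k'0 (has_infZ _ _ k0 hA); rewrite imK.
(* Without an infimum [inf] is 0 by default; scaling back by [k^-1] shows that the scaled set has
   none either. *)
rewrite [inf A]inf_out// mulr0 inf_out// => /(has_infZ _ _ k'0).
by rewrite imK.
Qed.

(** * Positive scaling of integrals and norms *)

Section integral_scaling.
Context d (T : measurableType d) (R : realType).
Context (mu : {measure set T -> \bar R}).
Implicit Types (k r : R).

(* Unlike [ge0_integralZl], no measurability is needed: nonnegative integrals
   are suprema over simple functions, a class stable under scaling. *)
Lemma ge0_integral_pZl k (f : T -> \bar R) : 0 < k -> (forall x, 0 <= f x)%E ->
  (\int[mu]_x (k%:E * f x) = k%:E * \int[mu]_x f x)%E.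
Proof.
gen have le : k f / 0 < k -> (forall x, 0 <= f x)%E ->
    (k%:E * \int[mu]_x f x <= \int[mu]_x (k%:E * f x))%E.
  move=> k0 f0.
  have kf0 x : (0 <= k%:E * f x)%E by rewrite mule_ge0// lee_fin ltW.
  rewrite !ge0_integralTE// -ereal_sup_pZl//.
  apply/ereal_supP => _ [_ [h hf <-] <-].
  apply: ereal_sup_ubound; exists (scale_nnsfun h (ltW k0)).
    by move=> x /=; rewrite EFinM lee_pmul2l// hf.
  by rewrite /scale_nnsfun /= -sintegralrM.
(* The converse is [le] for the factor [k^-1] and the function [k%:E * f x]. *)
move=> k0 f0; apply/le_anti; rewrite le// andbT -lee_pdivrMl//.
have k'0 : 0 < k^-1 by rewrite invr_gt0.
have kf0 x : (0 <= k%:E * f x)%E by rewrite mule_ge0// lee_fin ltW.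
apply: le_trans (le _ _ k'0 kf0) _.
under eq_integral do rewrite muleA -EFinM mulVf ?gt_eqF// mul1e.
by [].
Qed.

(** A positive factor passes through positive and negative parts, and their difference scales even
    when both integrals are infinite. Hence [cintegral] scales on arbitrary functions. *)
Lemma integral_pZl k (f : T -> \bar R) : 0 < k ->
  (\int[mu]_x (k%:E * f x) = k%:E * \int[mu]_x f x)%E.
Proof.
move=> k0; rewrite integralE [in RHS]integralE gt0_muleB//.
by rewrite ge0_funeposM ?ge0_funenegM ?(ltW k0)// !ge0_integral_pZl.
Qed.

Lemma Rintegral_pZl k (f : T -> R) : 0 < k ->
  \int[mu]_x (k * f x) = k * \int[mu]_x f x.
Proof. by move=> k0; rewrite /Rintegral -fine_gt0Z// -integral_pZl. Qed.

Lemma Lnorm_pZl k r (f : T -> \bar R) : 0 < k -> 0 < r ->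
  ('N[mu]_r%:E[(fun x => k%:E * f x)] = k%:E * 'N[mu]_r%:E[f])%E.
Proof.
move=> k0 r0; rewrite unlock.
under eq_integral => x _ do rewrite
  abseM abse_EFin gtr0_norm// poweRM ?lee_fin ?(ltW k0)// poweR_EFin.
rewrite ge0_integral_pZl ?powR_gt0//; last by move=> x; exact: poweR_ge0.
rewrite poweRM ?lee_fin ?powR_ge0//; last first.
  by apply: integral_ge0 => x _; exact: poweR_ge0.
by rewrite poweR_EFin -powRrM mulfV ?gt_eqF// powRr1// ltW.
Qed.

End integral_scaling.

(** * The energy space, the form and the action along a ray *)

Section ray_scaling.
Context {R : realType}.
Implicit Types (k p r alpha mu : R) (v phi : R * R -> R[i]).

Definition rscale k v : R * R -> R[i] := fun x => k%:C%C * v x.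

Lemma Re_realM k (z : R[i]) : complex.Re (k%:C%C * z) = k * complex.Re z.
Proof. by case: z => a b /=; rewrite mul0r subr0. Qed.

Lemma Im_realM k (z : R[i]) : complex.Im (k%:C%C * z) = k * complex.Im z.
Proof. by case: z => a b /=; rewrite mul0r addr0. Qed.

Lemma normc_realM k (z : R[i]) : 0 < k ->
  ComplexField.Normc.normc (k%:C%C * z) = k * ComplexField.Normc.normc z.
Proof.
move=> k0; rewrite ComplexField.Normc.normcM; congr (_ * _) => /=.
by rewrite expr0n addr0 sqrtr_sqr gtr0_norm.
Qed.

Lemma cintegral_rscale k v : 0 < k ->
  cintegral (rscale k v) = k%:C%C * cintegral v.
Proof.
move=> k0; apply/eqP; rewrite eq_complex Re_realM Im_realM /=.
under eq_Rintegral do rewrite Re_realM.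
under [X in _ && (X == _)]eq_Rintegral do rewrite Im_realM.
by rewrite !Rintegral_pZl// !eqxx.
Qed.

Lemma eLp_norm_rscale k r v : 0 < k -> 0 < r ->
  eLp_norm r (rscale k v) = (k%:E * eLp_norm r v)%E.
Proof.
move=> k0 r0; rewrite /eLp_norm -Lnorm_pZl//; congr Lnorm; apply/funext => x /=.
by rewrite normc_realM.
Qed.

Lemma Lp_norm_rscale k r v : 0 < k -> 0 < r ->
  Lp_norm r (rscale k v) = k * Lp_norm r v.
Proof. by move=> k0 r0; rewrite /Lp_norm eLp_norm_rscale// fine_gt0Z. Qed.

Lemma Lp_norm_ge0 r v : 0 <= Lp_norm r v.
Proof. by rewrite fine_ge0// Lnorm_ge0. Qed.

Lemma Lp_rscale k r v : 0 < k -> 0 < r -> Lp r v -> Lp r (rscale k v).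
Proof.
move=> k0 r0 [[mRe mIm] v_fin]; split; last first.
  by rewrite eLp_norm_rscale// lte_mul_pinfty// lee_fin ltW.
split.
- rewrite (_ : (fun x => _) = (fun x => k * complex.Re (v x))).
    exact: measurable_funM.
  by apply/funext => x; rewrite Re_realM.
- rewrite (_ : (fun x => _) = (fun x => k * complex.Im (v x))).
    exact: measurable_funM.
  by apply/funext => x; rewrite Im_realM.
Qed.

Lemma weak_gradient_rscale k phi (G : bool -> R * R -> R[i]) : 0 < k ->
  weak_gradient phi G -> weak_gradient (rscale k phi) (fun i => rscale k (G i)).
Proof.
move=> k0 hG i; have [LG wG] := hG i; split; first exact: Lp_rscale.
move=> psi hpsi.
have rscaleM f (h : R * R -> R[i]) :
    (fun x => rscale k f x * h x) = rscale k (fun x => f x * h x).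
  by apply/funext => x; rewrite /rscale mulrA.
by rewrite !rscaleM !cintegral_rscale// wG// mulrN.
Qed.

Lemma H1_rscale k phi : 0 < k -> H1 phi -> H1 (rscale k phi).
Proof.
move=> k0 [Lphi [G hG]]; split; first exact: Lp_rscale.
by exists (fun i => rscale k (G i)); exact: weak_gradient_rscale.
Qed.

(** The charge scales along with the function, so a decomposition is carried along the ray at the
    same [lambda]. *)
Lemma regular_part_rscale k lambda q v :
  regular_part lambda (k%:C%C * q) (rscale k v) =
  rscale k (regular_part lambda q v).
Proof.
by apply/funext => x; rewrite /rscale /regular_part mulrBr mulrA.
Qed.

Lemma energy_space_rscale k v : 0 < k ->
  energy_space v -> energy_space (rscale k v).
Proof.
move=> k0 [Lv [q [lambda [lambda0 Hphi]]]]; split; first exact: Lp_rscale.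
exists (k%:C%C * q), lambda; split=> //.
by rewrite regular_part_rscale; exact: H1_rscale.
Qed.

(** Every term of [form_value] is quadratic in the function, its gradient and its charge. Scaling a
    decomposition gives one inclusion, scaling back by [k^-1] the other. *)
Lemma form_values_rscale k alpha v : 0 < k ->
  form_values alpha (rscale k v) =
  [set k ^+ 2 * x | x in form_values alpha v]%classic.
Proof.
gen have sub : k v / 0 < k -> forall x, form_values alpha v x ->
    form_values alpha (rscale k v) (k ^+ 2 * x).
  move=> k0 _ [lambda [q [G [lambda0 Lphi hG ->]]]].
  exists lambda, (k%:C%C * q), (fun i => rscale k (G i)).
  rewrite /form_value regular_part_rscale normc_realM// !Lp_norm_rscale//.
  split=> //; [exact: Lp_rscale | exact: weak_gradient_rscale | ring].
move=> k0; apply/seteqP; split => [x|_ [x hx <-]]; last exact: sub.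
have k'0 : 0 < k^-1 by rewrite invr_gt0.
move=> /(sub _ _ k'0) hx; exists (k^-1 ^+ 2 * x).
  congr (form_values _ _ _): hx; apply/funext => y.
  by rewrite /rscale mulrA -rmorphM mulVf ?gt_eqF// mul1r.
by rewrite mulrA -exprMn mulfV ?gt_eqF// expr1n mul1r.
Qed.

Lemma Qform_rscale k alpha v : 0 < k ->
  Qform alpha (rscale k v) = k ^+ 2 * Qform alpha v.
Proof.
by move=> k0; rewrite /Qform form_values_rscale// inf_pZl// exprn_gt0.
Qed.

Lemma measurable_normc v : cmeasurable v ->
  measurable_fun [set: measurableTypeR R * measurableTypeR R]
    (fun x => ComplexField.Normc.normc (v x) : measurableTypeR R).
Proof.
move=> [mRe mIm]; rewrite (_ : (fun x => _) = Num.sqrt \o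
    (fun x => complex.Re (v x) ^+ 2 + complex.Im (v x) ^+ 2)).
  apply: measurableT_comp.
    by apply: continuous_measurable_fun; exact: sqrt_continuous.
  by apply: measurable_funD; exact: measurable_funX.
by apply/funext => x /=; case: (v x).
Qed.

(** Links the almost everywhere condition in [nehari] to the norm, by which the choice of the
    scaling factor divides. *)
Lemma Lp_norm_eq0 r v : 0 < r -> Lp r v ->
  Lp_norm r v = 0 <-> {ae leb2, forall x, v x = 0}.
Proof.
move=> r0 [/measurable_normc /measurable_EFinP mN v_fin].
have aeF : Filter (nbhs (almost_everywhere (@leb2 R))).
  exact: (ae_filter_ringOfSetsType (lebesgue_measure \x lebesgue_measure)%E).
split=> [/eqP|v0].
  rewrite fine_eq0; last by rewrite ge0_fin_numE// Lnorm_ge0.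
  move=> /eqP N0; have r0' : (0 < r%:E)%E by rewrite lte_fin.
  have := Lnorm_eq0_eq0 mN r0' N0; apply: filterS => x /(_ I) /= [].
  exact: ComplexField.Normc.eq0_normc.
rewrite /Lp_norm /eLp_norm unlock (ae_eq_integral (cst 0%E))//; last 2 first.
- apply: (measurableT_comp (measurable_poweR _)) => //.
  exact: measurableT_comp.
- apply: filterS v0 => x vx0 _ /=.
  by rewrite vx0 ComplexField.Normc.normc0 normr0 powR0// gt_eqF.
by rewrite integral0 poweR0r// gt_eqF// invr_gt0.
Qed.

Lemma action_rscale k alpha p omega v : 0 < k -> 0 < p ->
  action alpha p omega (rscale k v) =
  k ^+ 2 / 2 * (Qform alpha v + omega * Lp_norm 2 v ^+ 2)
  - k `^ p / p * Lp_norm p v `^ p.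
Proof.
move=> k0 p0; rewrite /action /energy Qform_rscale// !Lp_norm_rscale//.
by rewrite powRM ?Lp_norm_ge0 ?(ltW k0)//; ring.
Qed.

Lemma action_rscale_nehari k alpha p omega v : 0 < k -> 2 < p ->
  nehari_functional alpha p omega v = 0 ->
  action alpha p omega (rscale k v) <= action alpha p omega v.
Proof.
move=> k0 p2 /subr0_eq QP.
have p0 : 0 < p by apply: lt_trans p2.
rewrite action_rscale// QP -mulrBl.
have -> : action alpha p omega v = (1 / 2 - 1 / p) * Lp_norm p v `^ p.
  rewrite /action /energy.
  have -> : Qform alpha v = Lp_norm p v `^ p - omega * Lp_norm 2 v ^+ 2.
    by rewrite -QP addrK.
  by ring.
(* The p-th power of the norm factors out, leaving k^2/2 - k^p/p <= 1/2 - 1/p. *)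
rewrite ler_wpM2r ?powR_ge0//.
(* Young's inequality for the product [k ^ 2 * 1], with exponents [p / 2] and
   [p / (p - 2)]. *)
have young : k ^+ 2 <= k `^ p / (p / 2) + (1 - 2 / p).
  have := @conjugate_powR _ (k ^+ 2) 1 (p / 2) (p / (p - 2)).
  rewrite mulr1 powR1 -powR_mulrn ?(ltW k0)// -powRrM.
  rewrite (_ : 2%:R * (p / 2) = p); last by field.
  rewrite (_ : 1 / (p / (p - 2)) = 1 - 2 / p); last by field; lra.
  apply; rewrite ?powR_ge0 ?divr_gt0 ?subr_gt0//.
  by field; lra.
(* The claim is half of [young]; this form makes it linear in the terms occurring there. *)
have -> : k `^ p / p = k `^ p / (p / 2) / 2 by field; lra.
by lra.
Qed.

Lemma action_mass_sphere alpha p omega mu v : mass_sphere mu v ->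
  action alpha p omega v = energy alpha p v + omega / 2 * mu.
Proof. by move=> [_ <-]. Qed.

End ray_scaling.

(** * Comparison of the ground state with the Nehari manifold *)

Theorem lemma1p10 (R : realType) (p alpha mu : R) (u : R * R -> R[i])
    (hp : 2 < p) (hmu : 0 < mu) (hu : ground_state alpha p mu u) :
  action_minimizer alpha p (mu^-1 * (Lp_norm p u `^ p - Qform alpha u)) u.
Proof.
case: hu => u_mass u_min; have [u_space u_norm] := u_mass.
set omega := mu^-1 * _.
have two_gt0 : 0 < 2 :> R by rewrite ltr0n.
have u_nehari : nehari alpha p omega u.
  split=> //.
    have [Lu _] := u_space.
    move=> /(Lp_norm_eq0 _ _ two_gt0 Lu) u0.
    by move: hmu; rewrite -u_norm u0 expr0n ltxx.
  (* As [u] has mass [mu], the factor [mu^-1] in [omega] cancels and the functional vanishes. *)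
  by rewrite /nehari_functional /omega u_norm mulrAC mulVf ?gt_eqF//; ring.
split=> //; apply/le_anti/andP; split; last first.
  by apply: ereal_inf_lbound; exists u.
apply: le_ereal_inf_tmp => _ [v [v_space v_neq0 v_nehari] <-]; rewrite lee_fin.
have v_gt0 : 0 < Lp_norm 2 v.
  rewrite lt_neqAle Lp_norm_ge0 andbT eq_sym; apply/eqP.
  by have [Lv _] := v_space => /(Lp_norm_eq0 _ _ two_gt0 Lv).
(* The norm is homogeneous of degree one, so this factor brings it to the square root of [mu]. *)
pose k := Num.sqrt mu / Lp_norm 2 v.
have k0 : 0 < k by rewrite divr_gt0// sqrtr_gt0.
have kv_mass : mass_sphere mu (rscale k v).
  split; first exact: energy_space_rscale.
  by rewrite Lp_norm_rscale// divfK ?gt_eqF// sqr_sqrtr// ltW.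
apply: le_trans (action_rscale_nehari _ _ _ _ _ k0 hp v_nehari).
rewrite (action_mass_sphere _ _ _ _ _ u_mass) (action_mass_sphere _ _ _ _ _ kv_mass).
rewrite lerD2r -lee_fin u_min; apply: ereal_inf_lbound.
by exists (rscale k v).
Qed.
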